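(* Let $F,G:\mathbb{R}^q\times\mathbb{R}^q\to\mathbb{R}^q$, $(U,M)\mapsto F(U,M),\,G(U,M)$, be continuously differentiable, and let $(U^*,M^* )$ satisfy $F(U^*,M^* )=0$ and $G(U^*,M^* )=0$. Put $$F_u:=\frac{\partial F}{\partial U}(U^*,M^* ),\quad F_m:=\frac{\partial F}{\partial M}(U^*,M^* ),\quad G_u:=\frac{\partial G}{\partial U}(U^*,M^* ),\quad G_m:=\frac{\partial G}{\partial M}(U^*,M^* ),$$ and assume that $F_u$ and $G_m$ are invertible. Let $(U_k,M_k)_{k\ge1}$ be the iterates of alternating sweeping started from $M_0=M_{\mathrm{init}}$: for $k\ge 1$, $U_k$ is obtained from $F(U_k,M_{k-1})=0$ and then $M_k$ is obtained from $G(U_k,M_k)=0$. Let $\rho$ denote the spectral radius. Then: (i) $M_k$ converges to $M^*$ locally if $\rho(G_m^{-1}G_uF_u^{-1}F_m)<1$; (ii) $U_k$ converges to $U^*$ locally if $\rho(F_u^{-1}F_mG_m^{-1}G_u)<1$; (iii) the two conditions in (i) and (ii) are equivalent, and when they hold, the convergence rate of the alternating sweeping iteration is $$r=\rho(G_m^{-1}G_uF_u^{-1}F_m)=\rho(F_u^{-1}F_mG_m^{-1}G_u).$$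
   Context: In the application, $U,M\in\mathbb{R}^q$ collect all values of two grid functions on a space-time mesh; $F(U,M)=0$ is the discretized forward Hamilton-Jacobi-Bellman equation and $G(U,M)=0$ the discretized backward Kolmogorov-Fokker-Planck equation of a mean field game (all terms moved to the left-hand side). The statement uses only the listed assumptions on $F$ and $G$. Conventions. Since $F_u$ and $G_m$ are invertible, for $M$ near $M^*$ the equation $F(U,M)=0$ has a unique solution $U$ near $U^*$, and for $U$ near $U^*$ the equation $G(U,M)=0$ has a unique solution $M$ near $M^*$; the steps of the iteration refer to these local solutions. ''Converges locally'' means: there is a neighbourhood of $M^*$ such that for every $M_{\mathrm{init}}$ in it the iterates are well defined and the sequence in question converges to its limit. ''Convergence rate'' is the usual asymptotic linear (root) convergence factor of a fixed point iteration: the supremum, over all $M_{\mathrm{init}}$ in a sufficiently small neighbourhood of $M^*$, of $\limsup_{k\to\infty}\|M_k-M^*\|^{1/k}$ (respectively of $\limsup_{k\to\infty}\|U_k-U^*\|^{1/k}$); the claim is that both equal $r$. *)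

(* Defs.v *)
From mathcomp Require Import all_boot all_order all_algebra.
From mathcomp Require Import complex.
From mathcomp Require Import all_classical all_reals all_analysis.
Import Order.TTheory GRing.Theory Num.Theory.
Import numFieldNormedType.Exports.

Set Implicit Arguments.
Unset Strict Implicit.
Unset Printing Implicit Defensive.

Local Open Scope classical_set_scope.
Local Open Scope ring_scope.

(* Jacobian acting on column vectors on the left: entry (i, j) is the partial
   derivative of the i-th component with respect to the j-th coordinate. (The
   library's jacobian is for row vectors, hence transposed.) *)
Definition jac (R : realType) (q : nat) (f : 'cV[R]_q -> 'cV[R]_q)
    (x : 'cV[R]_q) : 'M[R]_q :=
  \matrix_(i, j) ('D_(delta_mx j 0) f x) i 0.

Definition jacU (R : realType) (q : nat)
    (H : 'cV[R]_q * 'cV[R]_q -> 'cV[R]_q) (p : 'cV[R]_q * 'cV[R]_q) : 'M[R]_q :=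
  jac (fun U => H (U, p.2)) p.1.

Definition jacM (R : realType) (q : nat)
    (H : 'cV[R]_q * 'cV[R]_q -> 'cV[R]_q) (p : 'cV[R]_q * 'cV[R]_q) : 'M[R]_q :=
  jac (fun M => H (p.1, M)) p.2.

Definition continuously_differentiable (R : realType) (q : nat)
    (H : 'cV[R]_q * 'cV[R]_q -> 'cV[R]_q) : Prop :=
  [/\ forall p, differentiable H p, continuous (jacU H) & continuous (jacM H)].

(* The eigenvalues are the complex ones. For q = 0 there is none and the value
   is sup set0 = 0. *)
Definition spectral_radius (R : realType) (q : nat) (A : 'M[R]_q) : R :=
  sup [set ComplexField.Normc.normc a |
        a in [set a : R[i]%C | eigenvalue (map_mx (real_complex R) A) a]].

(* Regions selecting the local solutions: for M in domM the equation
   F(U, M) = 0 is solved for U in winU, and for U in domU the equation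
   G(U, M) = 0 is solved for M in winM. *)
Record windows (T : Type) :=
  Windows { domM : set T; winU : set T; domU : set T; winM : set T }.

Definition local_windows (R : realType) (q : nat)
    (F G : 'cV[R]_q * 'cV[R]_q -> 'cV[R]_q) (Us Ms : 'cV[R]_q)
    (w : windows 'cV[R]_q) : Prop :=
  [/\ nbhs Ms (domM w) /\ nbhs Us (winU w),
      nbhs Us (domU w) /\ nbhs Ms (winM w),
      forall M, domM w M -> exists! U, winU w U /\ F (U, M) = 0
    & forall U, domU w U -> exists! M, winM w M /\ G (U, M) = 0].

(* The set of sequences x k = (U_k, M_k) of iterates started from m. The
   component U_0 = (x 0).1 plays no role and is unconstrained. *)
Definition sweeping (R : realType) (q : nat)
    (F G : 'cV[R]_q * 'cV[R]_q -> 'cV[R]_q) (w : windows 'cV[R]_q)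
    (m : 'cV[R]_q) : set (nat -> 'cV[R]_q * 'cV[R]_q) :=
  [set x | (x 0%N).2 = m /\
    forall k, [/\ domM w (x k).2, winU w (x k.+1).1
                & F ((x k.+1).1, (x k).2) = 0] /\
              [/\ domU w (x k.+1).1, winM w (x k.+1).2
                & G ((x k.+1).1, (x k.+1).2) = 0]].

(* Below, S m is the set of iteration sequences started from m, and pr selects
   the component (U or M) under consideration. S m !=set0 says that all
   iterates started from m are well defined. *)
Definition converges_locally (R : realType) (q : nat)
    (S : 'cV[R]_q -> set (nat -> 'cV[R]_q * 'cV[R]_q)) (Ms : 'cV[R]_q)
    (pr : 'cV[R]_q * 'cV[R]_q -> 'cV[R]_q) (l : 'cV[R]_q) : Prop :=
  \forall m \near Ms,
    S m !=set0 /\ forall x, S m x -> pr (x k) @[k --> \oo] --> l.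

Definition root_factor (R : realType) (q : nat) (y : nat -> 'cV[R]_q)
    (l : 'cV[R]_q) : \bar R :=
  limn_esup (fun k => (`|y k - l| `^ (k%:R^-1))%:E).

Definition has_convergence_rate (R : realType) (q : nat)
    (S : 'cV[R]_q -> set (nat -> 'cV[R]_q * 'cV[R]_q)) (Ms : 'cV[R]_q)
    (pr : 'cV[R]_q * 'cV[R]_q -> 'cV[R]_q) (l : 'cV[R]_q) (r : R) : Prop :=
  exists2 W0 : set 'cV[R]_q,
    nbhs Ms W0 /\ (forall m, W0 m -> S m !=set0) &
    forall W : set 'cV[R]_q, nbhs Ms W -> W `<=` W0 ->
      ereal_sup [set root_factor (pr \o x) l | x in \bigcup_(m in W) S m]
      = r%:E.

(* Main.v *)
Require Import Defs.
From HB Require Import structures.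
From mathcomp Require Import all_boot all_order all_algebra.
From mathcomp Require Import complex.
From mathcomp Require Import all_classical all_reals all_analysis.
From mathcomp Require Import ring lra.
Import Order.TTheory GRing.Theory Num.Theory.
Import numFieldNormedType.Exports.
Local Open Scope classical_set_scope.
Local Open Scope ring_scope.

Set Implicit Arguments.
Unset Strict Implicit.
Unset Printing Implicit Defensive.

(* By the implicit function theorem, obtained from Banach's fixed point theorem,
   one sweep maps the error e of M to A e + o(e), with
   A = Gm^-1 Gu Fu^-1 Fm, and the errors of U and M bound each other up to a
   constant. Triangularise A over the complex numbers and weight the i-th
   coordinate by t^i with t small: the off-diagonal part becomes negligible, and
   the moduli of the coordinates are seminorms multiplied by the moduli of the
   eigenvalues, up to an arbitrarily small error. Their weighted sum is a norm
   contracted by any factor above rho(A), which gives convergence and the upper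
   bound on the rate. For the lower bound, let N1 collect the coordinates with
   an eigenvalue of modulus rho(A) and N2 the others: the cone N2 < N1 is
   invariant under sweeps close to the solution, and N1 decreases there by at
   most any given factor below rho(A). The cone contains a real vector, since
   otherwise all real vectors, hence all complex ones, would decay under A faster
   than rho(A)^k, contradicting an eigenvector. Finally A = X Y and Y X have the
   same eigenvalues. *)

Local Notation normc := ComplexField.Normc.normc.

(** * Spectral radius and adapted seminorms *)

Section SpectralRadius.
Context {R : realType}.

Lemma normc_ge0 (z : R[i]) : 0 <= normc z.
Proof. by case: z => a b; exact: sqrtr_ge0. Qed.

Lemma normc_sum (I : Type) (r : seq I) (p : pred I) (f : I -> R[i]) :
  normc (\sum_(i <- r | p i) f i) <= \sum_(i <- r | p i) normc (f i).
Proof.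
elim/big_rec2: _ => [|i x y _ h]; first by rewrite ComplexField.Normc.normc0.
by rewrite (le_trans (le_normcD _ _))// lerD2l.
Qed.

(** The weights are [t ^ i]: conjugation by the diagonal matrix with these entries multiplies entry
    [(i, j)] of [T] by [t ^ (i - j)]. Off the diagonal [T] is nonzero only for [j < i], so each such
    entry shrinks by a factor at most [t]. *)
Lemma trig_weights q (T : 'M[R[i]]_q) : is_trig_mx T ->
  forall e : R, 0 < e -> exists w : 'I_q -> R, (forall i, 0 < w i) /\
    forall z : 'cV[R[i]]_q,
      \sum_i w i * normc ((T *m z) i 0 - T i i * z i 0) <=
      e * \sum_i w i * normc (z i 0).
Proof.
move=> /is_trig_mxP Ttrig e e0.
pose K : R := \sum_i \sum_j normc (T i j).
have K0 : 0 <= K by do 2 (apply: sumr_ge0 => ? _); exact: normc_ge0.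
(* [K] bounds every column sum of moduli, so [t * K <= e] is what is needed; [t <= 1] makes the
   powers of [t] nonincreasing. *)
pose t := Num.min 1 (e / (K + 1)).
have t0 : 0 < t by rewrite lt_min ltr01 divr_gt0// ltr_wpDl.
have t1 : t <= 1 by rewrite ge_min lexx.
have tK : t * K <= e.
  have : t <= e / (K + 1) by rewrite ge_min lexx orbT.
  by rewrite ler_pdivlMr ?ltr_wpDl// => h; nra.
exists (fun i => t ^+ i); split=> [i|z]; first exact: exprn_gt0.
apply: (@le_trans _ _ (\sum_i \sum_j
    t * normc (T i j) * (t ^+ j * normc (z j 0)))).
  apply: ler_sum => i _.
  rewrite mxE (bigD1 i)//= addrAC subrr add0r.
  rewrite [leRHS](bigD1 i)//= ler_wpDl//.
    rewrite !mulr_ge0 ?normc_ge0 ?(ltW t0)//; exact/ltW/exprn_gt0.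
  apply: (@le_trans _ _ (\sum_(j < q | j != i)
      t ^+ i * (normc (T i j) * normc (z j 0)))).
    rewrite -mulr_sumr ler_wpM2l ?exprn_ge0 ?(ltW t0)//.
    apply: (le_trans (normc_sum _ _ _)).
    by apply: ler_sum => j _; rewrite ComplexField.Normc.normcM.
  apply: ler_sum => j ji.
  have [ij|] := ltnP i j.
    by rewrite Ttrig// ComplexField.Normc.normc0 mul0r !mulr0 mul0r.
  rewrite leq_eqVlt => /orP[/eqP/val_inj ji'|ji'].
    by rewrite ji' eqxx in ji.
  have tij : t ^+ i <= t * t ^+ j by rewrite -exprS ler_wiXn2l// ltW.
  have := ler_wpM2r (mulr_ge0 (normc_ge0 (T i j)) (normc_ge0 (z j 0))) tij.
  by move=> /le_trans; apply; rewrite le_eqVlt; apply/orP; left; apply/eqP; ring.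
rewrite exchange_big/= mulr_sumr; apply: ler_sum => j _.
rewrite -mulr_suml ler_wpM2r ?mulr_ge0 ?normc_ge0 ?exprn_ge0 ?(ltW t0)//.
rewrite -mulr_sumr (le_trans _ tK)// ler_wpM2l ?(ltW t0)//.
rewrite /K; apply: ler_sum => i _; rewrite (bigD1 j)//= lerDl.
by apply: sumr_ge0 => *; exact: normc_ge0.
Qed.

Lemma eigenvalue_trig (F : fieldType) q (T : 'M[F]_q) a : is_trig_mx T ->
  eigenvalue T a <-> exists i, a = T i i.
Proof.
move=> trT; rewrite eigenvalue_root_char char_poly_trig//.
rewrite -(big_map (fun i => T i i) xpredT (fun b => 'X - b%:P)) root_prod_XsubC.
split=> [/mapP[i _ ->]|[i ->]]; first by exists i.
by apply/mapP; exists i; rewrite // mem_index_enum.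
Qed.

Lemma eigenvalue_similar (F : fieldType) q (A T P : 'M[F]_q) a :
  P \in unitmx -> P *m A = T *m P -> eigenvalue A a = eigenvalue T a.
Proof.
move=> uP PA; apply/eigenvalueP/eigenvalueP => -[v va v0].
- exists (v *m invmx P); last first.
    apply: contraNneq v0 => /(congr1 (mulmx^~ P)).
    by rewrite mulmxKV// mul0mx => ->.
  have -> : T = P *m A *m invmx P by rewrite PA mulmxK.
  by rewrite !mulmxA mulmxKV// va scalemxAl.
- exists (v *m P); last first.
    apply: contraNneq v0 => /(congr1 (mulmx^~ (invmx P))).
    by rewrite mulmxK// mul0mx => ->.
  by rewrite -mulmxA PA mulmxA va scalemxAl.
Qed.

(** Eigenvectors are row vectors here; passing to the transpose supplies the column eigenvector on
    which [spectral_growth] iterates. *)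
Lemma eigenvalue_trmx (F : fieldType) q (A : 'M[F]_q) a :
  eigenvalue A^T a = eigenvalue A a.
Proof.
rewrite !eigenvalue_root_char /char_poly -[in RHS]det_tr; congr (root (\det _) a).
by apply/matrixP => i j; rewrite !mxE eq_sym.
Qed.

Lemma trigonalization q (A : 'M[R[i]]_q) :
  exists P T : 'M[R[i]]_q, [/\ P \in unitmx, is_trig_mx T & P *m A = T *m P].
Proof.
have [|P Punit] := @cotrigonalization R[i] q [:: A].
  by move=> B D; rewrite !inE => /eqP-> /eqP->.
rewrite /= andbT => trP; have uP := unitarymx_unit Punit.
exists P, (conjmx P A); split=> //.
by rewrite conjumx// mulmxKV.
Qed.

Lemma spectral_radius_ge q (A : 'M[R]_q) (a : R[i]) :
  eigenvalue (map_mx (real_complex R) A) a -> normc a <= spectral_radius A.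
Proof.
move=> ea; rewrite /spectral_radius.
have [P [T [uP trT PA]]] := trigonalization (map_mx (real_complex R) A).
apply: sup_ubound; last by exists a.
(* The supremum needs a bounded set: all eigenvalues are diagonal entries of [T]. *)
exists (\sum_i normc (T i i)) => _ [b /= eb <-].
move: eb; rewrite (eigenvalue_similar _ uP PA).
move=> /(eigenvalue_trig _ trT)[i ->].
by rewrite (bigD1 i)//= lerDl; apply: sumr_ge0 => *; exact: normc_ge0.
Qed.

(** The supremum runs over the finitely many diagonal entries of a triangular form, hence is
    attained. Positivity excludes [q = 0], where the set is empty. *)
Lemma spectral_radius_max q (A : 'M[R]_q) : 0 < spectral_radius A ->
  exists2 a : R[i], eigenvalue (map_mx (real_complex R) A) a
                  & normc a = spectral_radius A.
Proof.
move=> r0.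
have [P [T [uP trT PA]]] := trigonalization (map_mx (real_complex R) A).
have eT i : eigenvalue (map_mx (real_complex R) A) (T i i).
  by rewrite (eigenvalue_similar _ uP PA); apply/(eigenvalue_trig _ trT); exists i.
case: q => [|q] in A r0 P T uP trT PA eT *.
  move: r0; rewrite /spectral_radius (_ : [set _ | _ in _] = set0) ?sup0 ?ltxx//.
  rewrite -subset0 => _ [a /= + _]; rewrite (eigenvalue_similar _ uP PA).
  by move=> /(eigenvalue_trig _ trT)[[]].
pose i := [arg max_(i > ord0) normc (T i i)]%O.
exists (T i i) => //; apply/le_anti; rewrite (spectral_radius_ge (eT i))/=.
apply: ge_sup.
  by exists (normc (T ord0 ord0)), (T ord0 ord0) => //; exact: eT.
move=> _ [b /= eb <-]; move: eb; rewrite (eigenvalue_similar _ uP PA).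
move=> /(eigenvalue_trig _ trT)[j ->]; rewrite /i.
by case: arg_maxP => // k _; apply.
Qed.

Lemma spectral_radius_ge0 q (A : 'M[R]_q) : 0 <= spectral_radius A.
Proof.
have [P [T [uP trT PA]]] := trigonalization (map_mx (real_complex R) A).
case: q => [|q] in A P T uP trT PA *.
  rewrite /spectral_radius (_ : [set _ | _ in _] = set0) ?sup0 ?ltxx//.
  rewrite -subset0 => _ [a /= + _]; rewrite (eigenvalue_similar _ uP PA).
  by move=> /(eigenvalue_trig _ trT)[[]].
apply: le_trans (normc_ge0 (T ord0 ord0)) (spectral_radius_ge _).
rewrite (eigenvalue_similar _ uP PA); apply/(eigenvalue_trig _ trT).
by exists ord0.
Qed.

(** If [v] is an eigenvector of [X Y] for [a != 0], then [v X] is one of [Y X], nonzero because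
    [v X = 0] would give [a v = 0]. For [a = 0] the determinants of the two products are compared
    instead. *)
Lemma eigenvalue_mulC (F : fieldType) q (X Y : 'M[F]_q) a :
  eigenvalue (X *m Y) a -> eigenvalue (Y *m X) a.
Proof.
have [->|a0] := eqVneq a 0.
  have e0 (Z : 'M[F]_q) : eigenvalue Z 0 = (\det Z == 0).
    apply/eigenvalueP/det0P => -[v]; first by rewrite scale0r; exists v.
    by move=> v0 vZ; exists v; rewrite ?scale0r.
  by rewrite !e0 !det_mulmx mulrC.
move=> /eigenvalueP[v va v0]; apply/eigenvalueP; exists (v *m X).
  by rewrite mulmxA -(mulmxA v) va scalemxAl.
apply: contraNneq v0 => vX; move: va; rewrite mulmxA vX mul0mx => /esym/eqP.
by rewrite scaler_eq0 (negPf a0).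
Qed.

(** * Seminorms, adapted norms and expanding cones of a real matrix *)

Definition seminorm q (N : 'cV[R]_q -> R) :=
  (forall x y, N (x + y) <= N x + N y) /\
  (forall s x, N (s *: x) = `|s| * N x).

Lemma seminorm_ge0 q (N : 'cV[R]_q -> R) x : seminorm N -> 0 <= N x.
Proof.
move=> [ND NZ]; have := ND x (- 1 *: x).
rewrite scaleN1r subrr -(scale0r 0) -scaleN1r !NZ.
rewrite !normr0 !normrN normr1 mul0r mul1r.
by lra.
Qed.

Lemma seminorm_dist q (N : 'cV[R]_q -> R) x y :
  seminorm N -> `|N x - N y| <= N (x - y).
Proof.
move=> [ND NZ]; rewrite ler_distl.
have := ND (x - y) y; rewrite subrK.
have := ND (y - x) x; rewrite subrK.
have -> : N (y - x) = N (x - y) by rewrite -opprB -scaleN1r NZ normrN normr1 mul1r.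
lra.
Qed.

Lemma mx_norm_le m n (x : 'M[R]_(m, n)) c :
  0 <= c -> (forall i j, `|x i j| <= c) -> `|x| <= c.
Proof.
move=> c0 xc; rewrite /Num.norm/= mx_normrE; apply/bigmax_leP.
by split=> // i _; exact: xc.
Qed.

Lemma mx_norm_ge m n (x : 'M[R]_(m, n)) i j : `|x i j| <= `|x|.
Proof.
by rewrite [leRHS]/Num.norm/= mx_normrE; exact: (le_bigmax _ _ (i, j)).
Qed.

Lemma normc_dist (u v : R[i]) : `|normc u - normc v| <= normc (u - v).
Proof.
rewrite ler_distl.
have := le_normcD (u - v) v; rewrite subrK.
have := le_normcD (v - u) u; rewrite subrK -opprB normcN.
lra.
Qed.

Lemma normc_real (x : R) : normc (real_complex R x) = `|x|.
Proof. by rewrite /= expr0n/= addr0 sqrtr_sqr. Qed.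

(* a i is the modulus of the i-th coordinate in a complex basis triangularising
   A, and d i the modulus of the i-th eigenvalue. *)
Lemma spectral_family q (A : 'M[R]_q) :
  exists (a : 'I_q -> 'cV[R]_q -> R) (d : 'I_q -> R),
  [/\ forall i, seminorm (a i),
      exists2 C, 0 < C & forall x,
        `|x| <= C * \sum_i a i x /\ forall i, a i x <= C * `|x|,
      forall i, 0 <= d i <= spectral_radius A
    & forall e, 0 < e -> exists w : 'I_q -> R, (forall i, 0 < w i) /\
        forall x, \sum_i w i * `|a i (A *m x) - d i * a i x| <=
                  e * \sum_i w i * a i x].
Proof.
have [P [T [uP trT PA]]] := trigonalization (map_mx (real_complex R) A).
pose z (x : 'cV[R]_q) := P *m map_mx (real_complex R) x.
have zA x : z (A *m x) = T *m z x by rewrite /z map_mxM !mulmxA PA.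
pose K (B : 'M[R[i]]_q) : R := \sum_i \sum_j normc (B i j).
have KB (B : 'M[R[i]]_q) i j : normc (B i j) <= K B.
  rewrite /K (bigD1 i)//= (bigD1 j)//= -addrA lerDl addr_ge0//.
    by apply: sumr_ge0 => *; exact: normc_ge0.
  by do 2 (apply: sumr_ge0 => ? _); exact: normc_ge0.
have K0 (B : 'M[R[i]]_q) : 0 <= K B.
  by do 2 (apply: sumr_ge0 => ? _); exact: normc_ge0.
have mulB (B : 'M[R[i]]_q) (y : 'cV[R[i]]_q) i :
    normc ((B *m y) i 0) <= K B * \sum_j normc (y j 0).
  rewrite mxE mulr_sumr (le_trans (normc_sum _ _ _))//.
  apply: ler_sum => j _; rewrite ComplexField.Normc.normcM.
  by rewrite ler_wpM2r ?normc_ge0.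
exists (fun i x => normc (z x i 0)), (fun i => normc (T i i)); split.
- move=> i; split=> [x y|s x].
    by rewrite /z map_mxD mulmxDr mxE le_normcD.
  by rewrite /z map_mxZ -scalemxAr mxE ComplexField.Normc.normcM normc_real.
(* [K (invmx P)] serves to recover [x] from [z x]; [K P * q] bounds [z x] by the maximum norm of
   [x]. *)
- pose C := 1 + K (invmx P) + K P * q%:R.
  have C0 : 0 < C by rewrite ltr_wpDr ?mulr_ge0// ltr_wpDr.
  exists C => // x; split=> [|i].
    have s0 : 0 <= \sum_i normc (z x i 0) by apply: sumr_ge0 => *; exact: normc_ge0.
    apply: mx_norm_le => [|i j]; first exact/mulr_ge0/s0/ltW.
    rewrite ord1 -normc_real.
    have -> : real_complex R (x i 0) = (invmx P *m z x) i 0.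
      by rewrite /z mulKmx// mxE.
    rewrite (le_trans (mulB _ _ _))// ler_wpM2r// /C.
    by rewrite addrAC lerDr addr_ge0// mulr_ge0.
  rewrite (le_trans (mulB _ _ _))// (@le_trans _ _ (K P * (q%:R * `|x|)))//.
    rewrite ler_wpM2l// mulr_natl -[X in _ *+ X](card_ord q) -sumr_const.
    by apply: ler_sum => j _; rewrite mxE normc_real mx_norm_ge.
  by rewrite mulrA ler_wpM2r// /C lerDr addr_ge0.
- move=> i; rewrite normc_ge0/=; apply: spectral_radius_ge.
  by rewrite (eigenvalue_similar _ uP PA); apply/eigenvalue_trig => //; exists i.
(* Since [d i * a i x] is the modulus of [T i i * z x i 0], the reverse triangle inequality reduces
   the claim to the complex estimate. *)
- move=> e e0; have [w [w0 hw]] := trig_weights trT e0.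
  exists w; split=> // x; rewrite (le_trans _ (hw (z x)))//.
  apply: ler_sum => i _; rewrite ler_wpM2l ?(ltW (w0 i))//.
  by rewrite zA -ComplexField.Normc.normcM normc_dist.
Qed.

(** Let [v] be a complex eigenvector whose eigenvalue [l] has maximal modulus, and [a], [b] its real
    and imaginary parts. Then [l ^ k v] is the complex combination of the two real orbits, and a
    nonzero coordinate of [v] provides [c]. *)
Lemma spectral_growth q (A : 'M[R]_q) : 0 < spectral_radius A ->
  exists (a b : 'cV[R]_q), exists2 c : R, 0 < c &
    forall k, c * spectral_radius A ^+ k <=
      `|iter k (mulmx A) a| + `|iter k (mulmx A) b|.
Proof.
move=> r0; have [l el lr] := spectral_radius_max r0.
have /eigenvalueP[u ul u0] : eigenvalue (map_mx (real_complex R) A)^T l.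
  by rewrite eigenvalue_trmx.
have [j uj] : exists j, u 0 j != 0.
  by apply/existsP; apply: contraNT u0; rewrite negb_exists => /forallP h;
    apply/eqP/rowP => j; rewrite mxE; apply/eqP; move: (h j); rewrite negbK.
pose v : 'cV[R[i]]_q := u^T.
have Av : map_mx (real_complex R) A *m v = l *: v.
  by rewrite -[map_mx _ _]trmxK -trmx_mul ul linearZ.
pose a := \col_i complex.Re (v i 0); pose b := \col_i complex.Im (v i 0).
have vk k : l ^+ k *: v = map_mx (real_complex R) (iter k (mulmx A) a) +
    'i%C *: map_mx (real_complex R) (iter k (mulmx A) b).
  elim: k => [|k ih] /=.
    by rewrite scale1r; apply/colP => i; rewrite !mxE [LHS]complexE.
  by rewrite !map_mxM scalemxAr -mulmxDr -ih -scalemxAr Av scalerA exprSr.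
exists a, b, (normc (v j 0)) => [|k].
  rewrite lt_neqAle normc_ge0 andbT eq_sym; apply: contraNneq uj.
  by move=> /ComplexField.Normc.eq0_normc; rewrite mxE => ->.
have /(congr1 (fun M => normc ((M : 'cV_q) j 0))) := vk k; rewrite mxE.
rewrite ComplexField.Normc.normcM.
have -> : normc (l ^+ k) = spectral_radius A ^+ k.
  rewrite -lr; elim: k => [|k ih].
    by rewrite !expr0 ComplexField.Normc.normc1.
  by rewrite !exprS ComplexField.Normc.normcM ih.
rewrite mulrC => ->; rewrite mxE (le_trans (le_normcD _ _))// lerD//.
  by rewrite mxE normc_real mx_norm_ge.
rewrite mxE ComplexField.Normc.normcM mxE normc_real.
have -> : normc 'i%C = 1 :> R by rewrite /= expr0n expr1n add0r sqrtr1.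
by rewrite mul1r mx_norm_ge.
Qed.

Lemma seminorm_sum q (I : finType) (p : pred I) (w : I -> R)
    (a : I -> 'cV[R]_q -> R) :
  (forall i, 0 <= w i) -> (forall i, seminorm (a i)) ->
  seminorm (fun x => \sum_(i | p i) w i * a i x).
Proof.
move=> w0 ha; split=> [x y|s x].
  rewrite -big_split/=; apply: ler_sum => i _; rewrite -mulrDr.
  by rewrite ler_wpM2l//; case: (ha i).
by rewrite mulr_sumr; apply: eq_bigr => i _; case: (ha i) => _ ->; rewrite mulrCA.
Qed.

Lemma weighted_family q (a : 'I_q -> 'cV[R]_q -> R) (w : 'I_q -> R) C :
  (forall i, seminorm (a i)) -> (forall i, 0 < w i) -> 0 < C ->
  (forall x, `|x| <= C * \sum_i a i x /\ forall i, a i x <= C * `|x|) ->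
  exists2 D, 0 < D & forall x,
    `|x| <= D * \sum_i w i * a i x /\
    forall p : pred 'I_q, \sum_(i | p i) w i * a i x <= D * `|x|.
Proof.
move=> ha w0 C0 hC; pose W := \sum_i w i; pose V := \sum_i (w i)^-1.
have wW i : w i <= W.
  by rewrite /W (bigD1 i)//= lerDl; apply: sumr_ge0 => ? _; exact/ltW.
have wV i : (w i)^-1 <= V.
  by rewrite /V (bigD1 i)//= lerDl; apply: sumr_ge0 => ? _; rewrite invr_ge0 ltW.
have W0 : 0 <= W by apply: sumr_ge0 => ? _; exact/ltW.
have V0 : 0 <= V by apply: sumr_ge0 => ? _; rewrite invr_ge0 ltW.
have a0 i x : 0 <= a i x by apply: seminorm_ge0.
exists (1 + C * V + C * W).
  by rewrite -addrA ltr_wpDr// addr_ge0// mulr_ge0// ltW.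
move=> x; have [h1 h2] := hC x; split=> [|p].
  apply: (le_trans h1); apply: (@le_trans _ _ (C * V * \sum_i w i * a i x)).
    rewrite -mulrA ler_wpM2l ?(ltW C0)// mulr_sumr; apply: ler_sum => i _.
    rewrite mulrA ler_peMl// -(@mulVf _ (w i)) ?gt_eqF//.
    by rewrite ler_wpM2r// ltW.
  rewrite ler_wpM2r//; first by apply: sumr_ge0 => i _; rewrite mulr_ge0// ltW.
  by rewrite addrAC lerDr addr_ge0// mulr_ge0// ltW.
apply: (@le_trans _ _ (C * W * `|x|)).
  rewrite /W [C * _]mulrC -mulrA mulr_suml.
  apply: (@le_trans _ _ (\sum_(i | p i) w i * (C * `|x|))).
    by apply: ler_sum => i _; rewrite ler_wpM2l// ltW.
  rewrite big_mkcond/=; apply: ler_sum => i _; case: ifP => // _.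
  by rewrite !mulr_ge0// ltW.
by rewrite ler_wpM2r// lerDr addr_ge0// mulr_ge0// ltW.
Qed.

(** [N] is the weighted sum of the seminorms of [spectral_family]. Half of the gap [th - rho(A)]
    pays for the off-diagonal part of [A], the other half for the perturbation [y - A x]; [eta]
    carries [D ^ 2] because [D] is lost once in passing to [N] and once in returning. *)
Lemma adapted_norm q (A : 'M[R]_q) (th : R) : spectral_radius A < th ->
  exists (N : 'cV[R]_q -> R), exists2 C, 0 < C & exists2 eta, 0 < eta &
    (forall x, `|x| <= C * N x /\ N x <= C * `|x|) /\
    forall x y, `|y - A *m x| <= eta * `|x| -> N y <= th * N x.
Proof.
move=> rth; have [a [d [ha [C C0 hC] hd hw]]] := spectral_family A.
pose e := (th - spectral_radius A) / 2.
have e0 : 0 < e by rewrite divr_gt0 ?subr_gt0.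
have [w [w0 {}hw]] := hw e e0.
have [D D0 hD] := weighted_family ha w0 C0 hC.
pose N x := \sum_i w i * a i x.
have NS : seminorm N by apply: seminorm_sum => // i; exact: ltW.
have N0 x : 0 <= N x by exact: seminorm_ge0.
have D2 : 0 < D ^+ 2 by rewrite exprn_gt0.
exists N, D => //; exists (e / D ^+ 2); first by rewrite divr_gt0.
split=> [x|x y yx]; first by have [h1 h2] := hD x; split=> //; exact: (h2 predT).
have h1 : N (A *m x) <= (spectral_radius A + e) * N x.
  rewrite mulrDl; apply: le_trans (lerD (lexx _) (hw x)).
  rewrite mulr_sumr -big_split/=; apply: ler_sum => i _.
  rewrite mulrCA -mulrDr ler_wpM2l ?(ltW (w0 i))//.
  have /andP[_ di] := hd i.
  have := ler_wpM2r (seminorm_ge0 x (ha i)) di.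
  have := ler_norm (a i (A *m x) - d i * a i x).
  lra.
have h2 : N y <= N (A *m x) + N (y - A *m x).
  by case: NS => /(_ (A *m x) (y - A *m x)) + _; rewrite addrC subrK addrC.
have h3 : N (y - A *m x) <= e * N x.
  apply: (le_trans ((hD _).2 predT)).
  apply: (@le_trans _ _ (D * (e / D ^+ 2 * (D * N x)))).
    rewrite ler_wpM2l ?(ltW D0)// (le_trans yx)// ler_wpM2l//.
      by rewrite ltW// divr_gt0.
    by have [] := hD x.
  by rewrite le_eqVlt; apply/orP; left; apply/eqP; field; rewrite gt_eqF.
have : th = spectral_radius A + e + e by rewrite /e; lra.
by move=> ->; rewrite mulrDl; lra.
Qed.

Lemma geometric_lt (K c mu rho : R) : 0 < c -> 0 <= mu < rho ->
  \forall k \near \oo, K * mu ^+ k < c * rho ^+ k.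
Proof.
move=> c0 /andP[mu0 murho]; have rho0 : 0 < rho by lra.
have K0 : 0 < 1 + `|K| by rewrite ltr_pwDl.
have /cvgrPdist_lt /(_ (c / (1 + `|K|))) : (mu / rho) ^+ k @[k --> \oo] --> (0 : R).
  by apply: cvg_expr; rewrite ger0_norm ?divr_ge0// ?ltW// ltr_pdivrMr// mul1r.
move=> /(_ (divr_gt0 c0 K0)); apply: filterS => k.
rewrite sub0r normrN ger0_norm ?exprn_ge0 ?divr_ge0 ?(ltW rho0)//.
rewrite ltr_pdivlMr// expr_div_n mulrAC ltr_pdivrMr ?exprn_gt0//.
move=> /(le_lt_trans _); apply.
rewrite mulrC ler_wpM2l ?exprn_ge0//.
have := ler_norm K; lra.
Qed.

(** [N1] and [N2] are the weighted sums over the indices with [d i = rho] and [d i != rho]. The gap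
    between [rho] and the other moduli lets [N1] outgrow [N2], even after the errors committed
    inside the cone. *)
Lemma expanding_cone q (A : 'M[R]_q) (sg : R) :
  0 < spectral_radius A -> sg < spectral_radius A ->
  exists N1 N2 : 'cV[R]_q -> R, [/\ seminorm N1, seminorm N2,
    exists2 C, 0 < C & forall x, N1 x <= C * `|x|,
    exists x, N2 x < N1 x
  & exists2 eta, 0 < eta & forall x y, `|y - A *m x| <= eta * `|x| ->
      N2 x < N1 x -> N2 y < N1 y /\ sg * N1 x <= N1 y].
Proof.
set rho := spectral_radius A => rho0 sgrho.
have [a [d [ha [C C0 hC] hd hw]]] := spectral_family A.
have [th [th0 thrho hth]] : exists th, [/\ 0 <= th, th < rho &
    forall i, d i != rho -> d i <= th].
  (* The largest of the other moduli, or 0 if there are none; it is below [rho] as a finite maximum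
     of smaller numbers, using [0 < rho]. *)
  exists (\big[Num.max/0]_(i | d i != rho) d i); split.
  - by apply: bigmax_ge_id.
  - apply/bigmax_ltP; split=> // i di; rewrite lt_neqAle di/=.
    by case/andP: (hd i).
  - by move=> i di; exact: le_bigmax_cond.
pose m := Num.max th sg.
have [mth msg mrho] : [/\ th <= m, sg <= m & m < rho].
  by rewrite /m !le_max !lexx orbT gt_max thrho sgrho.
(* In the cone [N1 + N2 < 2 * N1], so the off-diagonal error and the perturbation cost at most
   [2 * e * N1] each. The factor 16 keeps [rho - 4 * e] strictly above [m + 4 * e]. *)
pose e := (rho - m) / 16.
have e0 : 0 < e by rewrite /e; lra.
have me : m + 4 * e < rho - 4 * e by rewrite /e; lra.
have [w [w0 {}hw]] := hw e e0.
have [D D0 hD] := weighted_family ha w0 C0 hC.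
pose Np (p : pred 'I_q) x := \sum_(i | p i) w i * a i x.
have NpS p : seminorm (Np p) by apply: seminorm_sum => // i; exact: ltW.
pose N1 := Np (fun i => d i == rho); pose N2 := Np (fun i => d i != rho).
have N12 x : \sum_i w i * a i x = N1 x + N2 x.
  by rewrite [LHS](bigID (fun i => d i == rho)).
have N1ge0 x : 0 <= N1 x by exact: (seminorm_ge0 x (NpS _)).
have N2ge0 x : 0 <= N2 x by exact: (seminorm_ge0 x (NpS _)).
have hNp p x : \sum_(i | p i) w i * `|a i (A *m x) - d i * a i x| <=
    e * (N1 x + N2 x).
  rewrite -N12 (le_trans _ (hw x))// big_mkcond/=; apply: ler_sum => i _.
  by case: ifP => // _; rewrite mulr_ge0// ltW.
have N1A x : rho * N1 x - e * (N1 x + N2 x) <= N1 (A *m x).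
  rewrite lerBlDr; apply: le_trans (lerD (lexx _) (hNp (fun i => d i == rho) x)).
  rewrite /N1 /Np mulr_sumr -big_split/=; apply: ler_sum => i /eqP di.
  rewrite mulrCA -mulrDr ler_wpM2l ?(ltW (w0 i))// di.
  have := ler_norm (- (a i (A *m x) - rho * a i x)); rewrite normrN; lra.
have N2A x : N2 (A *m x) <= th * N2 x + e * (N1 x + N2 x).
  apply: le_trans (lerD (lexx _) (hNp (fun i => d i != rho) x)).
  rewrite /N2 /Np mulr_sumr -big_split/=; apply: ler_sum => i di.
  rewrite mulrCA -mulrDr ler_wpM2l ?(ltW (w0 i))//.
  have := ler_wpM2r (seminorm_ge0 x (ha i)) (hth i di).
  have := ler_norm (a i (A *m x) - d i * a i x); lra.
have D2 : 0 < D ^+ 2 by rewrite exprn_gt0.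
exists N1, N2; split; [exact: NpS|exact: NpS| | |].
- by exists D => // x; exact: ((hD x).2 (fun i => d i == rho)).
(* Without a cone vector, [N1 <= N2] everywhere; then [N2] dominates the norm and every real orbit
   is [O(mu ^ k)] with [mu < rho], against [spectral_growth]. This also covers the possibility that
   no index has [d i = rho]. *)
- apply: contrapT => /forallNP nocone.
  have N1N2 x : N1 x <= N2 x by rewrite leNgt; apply/negP/nocone.
  pose mu := th + 2 * e.
  have mu0 : 0 <= mu < rho by rewrite /mu; lra.
  have iterN2 k x : N2 (iter k (mulmx A) x) <= mu ^+ k * N2 x.
    elim: k => [|k ih]; first by rewrite mul1r.
    rewrite exprS -mulrA; apply: (@le_trans _ _ (mu * N2 (iter k (mulmx A) x))).
      have := N2A (iter k (mulmx A) x).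
      have := ler_wpM2l (ltW e0) (N1N2 (iter k (mulmx A) x)).
      by rewrite /= /mu; lra.
    by rewrite ler_wpM2l//; case/andP: mu0.
  have iterD k x : `|iter k (mulmx A) x| <= 2 * D * N2 x * mu ^+ k.
    have := (hD (iter k (mulmx A) x)).1; rewrite N12 => /le_trans; apply.
    have -> : 2 * D * N2 x * mu ^+ k = D * (2 * (mu ^+ k * N2 x)) by ring.
    rewrite ler_wpM2l ?(ltW D0)//.
    have := iterN2 k x; have := N1N2 (iter k (mulmx A) x); lra.
  have [u [v [c c0 huv]]] := spectral_growth rho0.
  have [k _ /(_ k (leqnn k))/=] :=
    geometric_lt (2 * D * N2 u + 2 * D * N2 v) c0 mu0.
  apply/negP; rewrite -leNgt (le_trans (huv k))// mulrDl.
  by rewrite lerD.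
- exists (e / D ^+ 2) => [|x y yx cx]; first by rewrite divr_gt0.
  have noise p : `|Np p y - Np p (A *m x)| <= e * (N1 x + N2 x).
    apply: (le_trans (seminorm_dist _ _ (NpS p))); apply: (le_trans ((hD _).2 p)).
    apply: (@le_trans _ _ (D * (e / D ^+ 2 * (D * (N1 x + N2 x))))).
      rewrite ler_wpM2l ?(ltW D0)// (le_trans yx)// ler_wpM2l//.
        by rewrite ltW// divr_gt0.
      by have [] := hD x; rewrite N12.
    by rewrite le_eqVlt; apply/orP; left; apply/eqP; field; rewrite gt_eqF.
  have : `|N1 y - N1 (A *m x)| <= e * (N1 x + N2 x) by exact: noise.
  have : `|N2 y - N2 (A *m x)| <= e * (N1 x + N2 x) by exact: noise.
  rewrite !ler_norml => /andP[_ n2] /andP[n1 _].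
  have a1 := N1A x; have a2 := N2A x.
  have ecx := ler_wpM2l (ltW e0) (ltW cx).
  have tcx := ler_wpM2l th0 (ltW cx).
  have N1x : 0 < N1 x by exact: le_lt_trans (N2ge0 x) cx.
  have h1 : (rho - 4 * e) * N1 x <= N1 y by lra.
  have h2 : N2 y <= (th + 4 * e) * N1 x by lra.
  split.
    apply: (le_lt_trans h2); apply: lt_le_trans h1.
    by rewrite ltr_pM2r//; lra.
  by apply: le_trans h1; rewrite ler_pM2r//; lra.
Qed.

End SpectralRadius.

(** * Implicit functions *)

Section ImplicitFunctions.
Context {R : realType}.

Lemma diff_jac q (f : 'cV[R]_q -> 'cV[R]_q) x v :
  differentiable f x -> 'd f x v = jac f x *m v.
Proof.
move=> df; have -> : v = \sum_j v j 0 *: delta_mx j 0.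
  by rewrite [LHS]matrix_sum_delta; apply: eq_bigr => j _; rewrite big_ord1.
rewrite linear_sum mulmx_sumr; apply: eq_bigr => j _.
rewrite linearZ/= -scalemxAr -deriveE//; congr (_ *: _).
by apply/colP => i; rewrite -colE !mxE.
Qed.

Lemma differentiable_partialU q (H : 'cV[R]_q * 'cV[R]_q -> 'cV[R]_q) p :
  differentiable H p -> differentiable (fun U => H (U, p.2)) p.1.
Proof.
by case: p => u m dH; apply: (@differentiable_comp _ _ _ _ (fun U => (U, m)) H).
Qed.

Lemma differentiable_partialM q (H : 'cV[R]_q * 'cV[R]_q -> 'cV[R]_q) p :
  differentiable H p -> differentiable (fun M => H (p.1, M)) p.2.
Proof.
by case: p => u m dH; apply: (@differentiable_comp _ _ _ _ (fun M => (u, M)) H).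
Qed.

Lemma diff_jacUM q (H : 'cV[R]_q * 'cV[R]_q -> 'cV[R]_q) p u m :
  differentiable H p -> 'd H p (u, m) = jacU H p *m u + jacM H p *m m.
Proof.
move=> dH.
have -> : (u, m) = (u, 0) + (0, m) :> 'cV[R]_q * 'cV[R]_q.
  by apply/pair_equal_spec; rewrite /= addr0 add0r.
rewrite linearD; congr (_ + _).
  rewrite -(diff_jac _ (differentiable_partialU dH)).
  rewrite -(deriveE _ dH) -(deriveE _ (differentiable_partialU dH)).
  (* The difference quotients of [H] along [(u, 0)] and of its partial map along [u] are the same
     function of [h]. *)
  apply: (congr1 (fun f : R -> 'cV[R]_q => lim (f @ 0^'))); apply/funext => h /=.
  by congr (_ *: (H _ - H _)); rewrite /= -?surjective_pairing//;
    apply/pair_equal_spec; rewrite /= scaler0 add0r.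
rewrite -(diff_jac _ (differentiable_partialM dH)).
rewrite -(deriveE _ dH) -(deriveE _ (differentiable_partialM dH)).
apply: (congr1 (fun f : R -> 'cV[R]_q => lim (f @ 0^'))); apply/funext => h /=.
by congr (_ *: (H _ - H _)); rewrite /= -?surjective_pairing//;
    apply/pair_equal_spec; rewrite /= scaler0 add0r.
Qed.

Lemma diff_remainder (V W : normedModType R) (H : V -> W) p e :
  differentiable H p -> 0 < e ->
  \forall x \near p, `|H x - H p - 'd H p (x - p)| <= e * `|x - p|.
Proof.
move=> /diff_locally/eqaddoP dH e0.
rewrite (near_shift 0 p) /=; have := dH _ e0; apply: filterS => h /=.
by rewrite /shift/= subr0 addrK; apply: le_trans; rewrite opprD addrA.
Qed.

Lemma mulmx_norm_le m n (B : 'M[R]_(m, n)) (x : 'cV[R]_n) :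
  `|B *m x| <= n%:R * `|B| * `|x|.
Proof.
apply: mx_norm_le => [|i j]; first by rewrite !mulr_ge0.
rewrite mxE (le_trans (ler_norm_sum _ _ _))// -mulrA mulr_natl.
rewrite -[X in _ *+ X](card_ord n) -sumr_const; apply: ler_sum => k _.
by rewrite normrM ler_pM// mx_norm_ge.
Qed.

Lemma is_derive_line q (f : 'cV[R]_q -> 'cV[R]_q) (y v : 'cV[R]_q) (t : R) i :
  differentiable f (y + t *: v) ->
  is_derive t (1 : R) (fun s : R => f (y + s *: v) i 0)
    ((jac f (y + t *: v) *m v) i 0).
Proof.
move=> df; have := diff_derivable (v := v) df.
rewrite -(diff_jac _ df) -(deriveE _ df) /derivable /derive.
set F := fun h : R => h^-1 *: ((f \o shift (y + t *: v)) (h *: v) - f (y + t *: v)).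
move=> dF.
have FE : (fun h : R => h^-1 *:
      (((fun s : R => f (y + s *: v) i 0) \o shift t) (h *: 1)
       - f (y + t *: v) i 0)) = (fun M : 'cV[R]_q => M i 0) \o F.
  apply/funext => h; rewrite /F /= !mxE /shift/=.
  by congr (_ * (f _ i 0 - _)); rewrite [h *: 1]mulr1 scalerDl addrCA addrC.
have cF : (fun M : 'cV[R]_q => M i 0) \o F @ 0^' --> (lim (F @ 0^')) i 0.
  by apply: cvg_comp dF _; exact: coord_continuous.
apply: DeriveDef.
  by rewrite /derivable FE; apply: cvgP cF.
by rewrite /derive FE; apply: cvg_lim cF.
Qed.

(** The scalar mean value theorem is applied to each coordinate along the segment from [y] to [x],
    which stays in the ball by convexity. The intermediate point depends on the coordinate, which is
    harmless for the maximum norm. *)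
Lemma mean_value q (f : 'cV[R]_q -> 'cV[R]_q) (B : 'M[R]_q) c r k :
  (forall x, differentiable f x) ->
  (forall x, `|x - c| <= r -> `|jac f x - B| <= k) ->
  forall x y, `|x - c| <= r -> `|y - c| <= r ->
    `|f x - f y - B *m (x - y)| <= q%:R * k * `|x - y|.
Proof.
move=> df hk x y xr yr.
have k0 : 0 <= k by exact: le_trans (hk x xr).
apply: mx_norm_le => [|i j]; first by rewrite !mulr_ge0.
rewrite ord1; pose v := x - y.
have [||t] := @MVT_segment R (fun s : R => f (y + s *: v) i 0)
  (fun s : R => (jac f (y + s *: v) *m v) i 0) 0 1 ler01.
- by move=> t _; exact: is_derive_line.
- apply: derivable_within_continuous => t _.
  by have [] := is_derive_line (v := v) i (df (y + t *: v)).
rewrite in_itv/= => /andP[t0 t1]; rewrite scale1r scale0r addr0 /v.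
rewrite [y + _]addrC subrK subr0 mulr1 => E.
have -> : (f x - f y - B *m (x - y)) i 0 = f x i 0 - f y i 0 - (B *m (x - y)) i 0.
  by rewrite !mxE.
rewrite E.
pose p := y + t *: v.
have pr : `|p - c| <= r.
  have -> : p - c = (1 - t) *: (y - c) + t *: (x - c).
    by apply/colP => l; rewrite !mxE; ring.
  rewrite (le_trans (ler_normD _ _))// !normrZ !ger0_norm ?subr_ge0//.
  have := ler_wpM2l t0 xr; have := @ler_wpM2l _ (1 - t) _ _ _ yr.
  by rewrite subr_ge0 => /(_ t1); lra.
have -> : (jac f (y + t *: (x - y)) *m (x - y)) i 0 - (B *m (x - y)) i 0 =
    ((jac f p - B) *m v) i 0.
  by rewrite mulmxBl !mxE.
rewrite (le_trans (mx_norm_ge _ _ _))// (le_trans (mulmx_norm_le _ _))//.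
by rewrite ler_wpM2r// ler_wpM2l// hk.
Qed.

(* The library makes matrices complete spaces and normed modules, but lacks the
   join of the two structures, which Banach's theorem requires. *)
HB.instance Definition _ m n := Complete.copy 'M[R]_(m, n) 'M[R]_(m, n).

(** * Local solvability, uniqueness and first-order expansion of the implicit function *)

Section ImplicitFunction.
Context (q : nat) (H : 'cV[R]_q * 'cV[R]_q -> 'cV[R]_q) (p : 'cV[R]_q * 'cV[R]_q).
Hypotheses (hH : continuously_differentiable H) (uJ : jacU H p \in unitmx).

(** The map [U - J^-1 H(U, M)], with [J] the partial Jacobian at [p], has zero derivative in [U] at
    [p]. Joint continuity of [jacU H] keeps this derivative small for all nearby [(U, M)], so the
    Lipschitz constant 1/2 is uniform in [M]. *)
Lemma partial_contraction : exists2 r, 0 < r &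
  forall M U U', `|M - p.2| <= r -> `|U - p.1| <= r -> `|U' - p.1| <= r ->
    `|U - U' - invmx (jacU H p) *m (H (U, M) - H (U', M))| <= 2^-1 * `|U - U'|.
Proof.
case: hH => dH cJ _; set J := jacU H p.
(* One factor [q] comes from [mulmx_norm_le], the other from [mean_value]. *)
pose K := q%:R * `|invmx J| * q%:R.
have K0 : 0 <= K by rewrite !mulr_ge0.
pose k := 2^-1 / (K + 1).
have k0 : 0 < k by rewrite divr_gt0// ltr_wpDl.
have Kk : K * k <= 2^-1.
  by rewrite /k mulrCA ler_piMr// ler_pdivrMr ?ltr_wpDl// mul1r lerDl.
have /cvgrPdist_le/(_ k k0) := cJ p.
move=> /nbhs_normP[d /= d0 hd].
exists (d / 2) => [|M U U' Mr Ur U'r]; first by rewrite divr_gt0.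
have hk x : `|x - p.1| <= d / 2 -> `|jac (fun U => H (U, M)) x - J| <= k.
  move=> xr; rewrite distrC; apply: (hd (x, M)); rewrite /= prod_normE/= gt_max.
  rewrite !(distrC _ x) !(distrC _ M); apply/andP; split; lra.
have dF x : differentiable (fun U => H (U, M)) x.
  exact: (differentiable_partialU (dH (x, M))).
have := mean_value dF hk Ur U'r => /= hm.
have -> : U - U' - invmx J *m (H (U, M) - H (U', M)) =
   - (invmx J *m (H (U, M) - H (U', M) - J *m (U - U'))).
  by rewrite [in RHS]mulmxBr (mulKmx uJ) opprB.
rewrite normrN (le_trans (mulmx_norm_le _ _))//.
have h0 : 0 <= q%:R * `|invmx J| by rewrite mulr_ge0.
apply: (le_trans (ler_wpM2l h0 hm)).
by rewrite mulrA ler_wpM2r// (le_trans _ Kk)// /K mulrA.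
Qed.

Lemma implicit_unique : exists2 r, 0 < r &
  forall M U U', `|M - p.2| <= r -> `|U - p.1| <= r -> `|U' - p.1| <= r ->
    H (U, M) = 0 -> H (U', M) = 0 -> U = U'.
Proof.
have [r r0 hr] := partial_contraction; exists r => // M U U' Mr Ur U'r HU HU'.
have := hr _ _ _ Mr Ur U'r; rewrite HU HU' subrr mulmx0 subr0 => h.
apply/eqP; rewrite -subr_eq0 -normr_le0; lra.
Qed.

(** Banach's theorem for the simplified Newton map [T] on a closed ball around [p.1], contracted by
    [partial_contraction]; fixed points of [T] are zeros of [H] because [J] is invertible. *)
Lemma implicit_exists e : H p = 0 -> 0 < e ->
  \forall M \near p.2, exists U, `|U - p.1| <= e /\ H (U, M) = 0.
Proof.
move=> Hp0 e0; have [r r0 hr] := partial_contraction.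
set J := jacU H p in hr.
pose s := Num.min e r.
have s0 : 0 < s by rewrite lt_min e0.
have [se sr] : s <= e /\ s <= r by rewrite !ge_min !lexx orbT.
(* With [H(p.1, M)] of size at most [k], [T] moves the centre by at most [s / 2]; the contraction
   adds at most another [s / 2], so the ball of radius [s] is mapped into itself. *)
pose k := s / 2 / (q%:R * `|invmx J| + 1).
have K0 : 0 <= q%:R * `|invmx J| by rewrite mulr_ge0.
have k0 : 0 < k by rewrite !divr_gt0// ltr_wpDl.
have cH : {for p.2, continuous (fun M => H (p.1, M))}.
  by case: hH => dH _ _; exact/differentiable_continuous/differentiable_partialM.
have /cvgrPdist_le/(_ k k0) := cH.
rewrite /= -surjective_pairing Hp0 => nk.
have nr : \forall M \near p.2, `|M - p.2| <= r.
  by apply/nbhs_normP; exists r => // M /= Mr; rewrite distrC ltW.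
near=> M.
have Mr : `|M - p.2| <= r by near: M.
have Mk : `|H (p.1, M)| <= k by rewrite -normrN -sub0r; near: M.
pose T U := U - invmx J *m H (U, M).
pose D := closed_ball_ (Num.Def.normr : 'cV[R]_q -> R) p.1 s.
have DE U : D U = (`|U - p.1| <= s) :> Prop by rewrite /D/closed_ball_/= distrC.
have TT U U' : D U -> D U' -> `|T U - T U'| <= 2^-1 * `|U - U'|.
  rewrite !DE => US US'; rewrite /T.
  have -> : U - invmx J *m H (U, M) - (U' - invmx J *m H (U', M)) =
     U - U' - invmx J *m (H (U, M) - H (U', M)).
    by rewrite mulmxBr opprD addrACA -opprD.
  by apply: hr => //; exact: le_trans sr.
have Dp : D p.1 by rewrite DE subrr normr0 ltW.
have Tp : `|T p.1 - p.1| <= s / 2.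
  rewrite /T addrAC subrr add0r normrN (le_trans (mulmx_norm_le _ _))//.
  apply: (le_trans (ler_wpM2l K0 Mk)).
  rewrite /k mulrCA ler_piMr//; first by rewrite divr_ge0// ltW.
  by rewrite ler_pdivrMr ?ltr_wpDl// mul1r lerDl.
have TD U : D U -> D (T U).
  move=> DU; rewrite DE -(subrK (T p.1) (T U)) -addrA.
  rewrite (le_trans (ler_normD _ _))//.
  have := TT _ _ DU Dp; move: DU; rewrite DE; lra.
have [] := @banach_fixed_point R 'cV[R]_q D (mkfun TD).
- exists (2^-1)%:nng; split => /=; first by rewrite invf_lt1// ltr1n.
  by move=> [U U'] [/= DU DU']; exact: TT.
- exact: closed_closed_ball_.
- by exists p.1.
move=> U DU UT; exists U; split; first by rewrite (le_trans _ se)// -DE.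
have : invmx J *m H (U, M) = 0.
  by apply/eqP; rewrite -oppr_eq0 -(inj_eq (addrI U)) addr0; apply/eqP.
by move=> /(congr1 (mulmx J)); rewrite mulKVmx// mulmx0.
Unshelve. all: end_near. Qed.

(** Multiplying the differential of [H] at [p] by [J^-1] gives an error small relative to
    [|u| + |v|], with [u], [v] the increments of [U] and [M]; the term in [u] is then absorbed to
    leave an error relative to [|v|] alone. *)
Lemma implicit_expansion e : H p = 0 -> 0 < e ->
  exists2 d, 0 < d & forall U M, `|U - p.1| < d -> `|M - p.2| < d ->
    H (U, M) = 0 ->
    `|U - p.1 + invmx (jacU H p) *m jacM H p *m (M - p.2)| <= e * `|M - p.2|.
Proof.
move=> Hp0 e0; case: hH => dH _ _; set J := jacU H p; set Jm := jacM H p.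
pose Y := invmx J *m Jm; pose K := q%:R * `|invmx J|; pose y := q%:R * `|Y|.
have K0 : 0 <= K by rewrite mulr_ge0.
have y0 : 0 <= y by rewrite mulr_ge0.
(* The bound 1/2 absorbs [|u|] and yields [|u| <= (1 + 2 * y) * |v|]; then
   [|u| + |v| <= (2 + 2 * y) * |v|] explains the other bound. *)
pose m := Num.min 2^-1 (e / (2 + 2 * y)).
have m0 : 0 < m by rewrite lt_min invr_gt0 ltr0n/= divr_gt0// ltr_wpDr// mulr_ge0.
have m2 : m <= 2^-1 by rewrite ge_min lexx.
have me : m * (2 + 2 * y) <= e.
  by rewrite -ler_pdivlMr ?ltr_wpDr ?mulr_ge0// /m ge_min lexx orbT.
pose k := m / (K + 1).
have k0 : 0 < k by rewrite divr_gt0// ltr_wpDl.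
have Kk : K * k <= m.
  by rewrite /k mulrCA ler_piMr ?(ltW m0)// ler_pdivrMr ?ltr_wpDl// mul1r lerDl.
have /nbhs_normP[d /= d0 hd] := diff_remainder (dH p) k0.
exists d => // U M Ud Md HUM.
have := hd (U, M); rewrite /= HUM Hp0 subrr sub0r normrN.
have -> : p - (U, M) = (p.1 - U, p.2 - M) by [].
have -> : (U, M) - p = (U - p.1, M - p.2) by [].
rewrite !prod_normE/= gt_max !(distrC p.1) !(distrC p.2) Ud Md => /(_ erefl).
rewrite diff_jacUM// -/J -/Jm.
set u := U - p.1; set v := M - p.2 => h.
have {}h : `|J *m u + Jm *m v| <= k * (`|u| + `|v|).
  apply: (le_trans h); rewrite ler_wpM2l ?(ltW k0)//.
  by rewrite ge_max lerDl lerDr !normr_ge0.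
have E : u + Y *m v = invmx J *m (J *m u + Jm *m v).
  by rewrite [RHS]mulmxDr mulKmx// mulmxA.
have h1 : `|u + Y *m v| <= m * (`|u| + `|v|).
  rewrite E (le_trans (mulmx_norm_le _ _))// (le_trans (ler_wpM2l K0 h))//.
  by rewrite mulrA ler_wpM2r ?addr_ge0.
have h2 : `|u| <= `|u + Y *m v| + y * `|v|.
  rewrite -[X in `|X| <= _](addrK (Y *m v)) (le_trans (ler_normB _ _))//.
  by rewrite lerD2l mulmx_norm_le.
have h3 : m * `|u| <= 2^-1 * `|u| by rewrite ler_wpM2r.
have h4 : m * `|v| <= 2^-1 * `|v| by rewrite ler_wpM2r.
have h5 : `|u| <= (1 + 2 * y) * `|v| by lra.
have h6 : m * `|u| <= m * ((1 + 2 * y) * `|v|) by rewrite ler_wpM2l// ltW.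
have h7 : m * (2 + 2 * y) * `|v| <= e * `|v| by rewrite ler_wpM2r.
by apply: (le_trans h1); lra.
Qed.

End ImplicitFunction.
End ImplicitFunctions.

(** * Convergence rates of iterations *)

Section Iterations.
Context {R : realType}.

Lemma exprn_powRK (t : R) k : 0 <= t -> (0 < k)%N -> (t ^+ k) `^ (k%:R^-1) = t.
Proof.
by move=> t0 k0; rewrite -powR_mulrn// -powRrM mulfV ?powRr1// pnatr_eq0 -lt0n.
Qed.

Lemma root_factor_le q (y : nat -> 'cV[R]_q) l (t : R) : 0 <= t ->
  (\forall k \near \oo, `|y k - l| <= t ^+ k) -> (root_factor y l <= t%:E)%E.
Proof.
move=> t0 yt; rewrite /root_factor /limn_esup limf_esupE.
(* The limit superior is an infimum over neighbourhoods of infinity, so one set suffices. Index 0 is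
   excluded because there the root has exponent [0^-1 = 0]. *)
pose V := [set k : nat | (0 < k)%N /\ `|y k - l| <= t ^+ k].
have nV : \oo V by near=> k; split; near: k => //; exact: nbhs_infty_gt.
apply: le_trans (ereal_inf_lbound _) _; first by exists V.
apply: ge_ereal_sup => _ [k [k0 yk] <-]; rewrite lee_fin.
by rewrite -[leRHS](exprn_powRK t0 k0) ge0_ler_powR ?nnegrE ?exprn_ge0 ?invr_ge0.
Unshelve. all: end_near. Qed.

Lemma root_factor_ge q (y : nat -> 'cV[R]_q) l (t : R) : 0 <= t ->
  (\forall k \near \oo, t ^+ k <= `|y k - l|) -> (t%:E <= root_factor y l)%E.
Proof.
move=> t0 yt; rewrite /root_factor /limn_esup limf_esupE.
apply: le_ereal_inf_tmp => _ [V nV <-].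
have [k [Vk [k0 yk]]] : exists k, V k /\ (0 < k)%N /\ t ^+ k <= `|y k - l|.
  near \oo => k; exists k; split; first by near: k.
  by split; near: k => //; exact: nbhs_infty_gt.
apply: le_trans (ereal_sup_ubound _); last by exists k.
rewrite lee_fin -[leLHS](exprn_powRK t0 k0).
by rewrite ge0_ler_powR ?nnegrE ?exprn_ge0 ?invr_ge0.
Unshelve. all: end_near. Qed.

Lemma root_factor_ge0 q (y : nat -> 'cV[R]_q) l : (0 <= root_factor y l)%E.
Proof.
apply: limf_esup_ge0 => [[] N _ /(_ N (leqnn N))//|k].
by rewrite lee_fin powR_ge0.
Qed.

(** * Orbits of a perturbed linear map *)

Section Steps.
Context (q : nat) (Us Ms : 'cV[R]_q) (A : 'M[R]_q) (C : R).
(* step M U M' stands for one sweep: U is computed from M, then M' from U. *)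
Context (step : 'cV[R]_q -> 'cV[R]_q -> 'cV[R]_q -> Prop).

Definition orbits (m : 'cV[R]_q) : set (nat -> 'cV[R]_q * 'cV[R]_q) :=
  [set x | (x 0%N).2 = m /\ forall k, step (x k).2 (x k.+1).1 (x k.+1).2].

Hypothesis C0 : 0 < C.
Hypothesis step_expansion : forall e, 0 < e -> exists2 d, 0 < d &
  (forall M, `|M - Ms| < d -> exists U M', step M U M') /\
  forall M U M', `|M - Ms| < d -> step M U M' ->
    [/\ `|M' - Ms - A *m (M - Ms)| <= e * `|M - Ms|,
        `|U - Us| <= C * `|M - Ms| & `|M' - Ms| <= C * `|U - Us|].

Lemma orbit_bound th : spectral_radius A < th < 1 ->
  exists2 d, 0 < d & exists2 K, 0 < K & forall m, `|m - Ms| < d ->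
    orbits m !=set0 /\
    forall x, orbits m x -> forall k, `|(x k).2 - Ms| <= K * th ^+ k * `|m - Ms|.
Proof.
move=> /andP[rth th1].
have th0 : 0 <= th by exact: le_trans (spectral_radius_ge0 A) (ltW rth).
have [N [D D0 [eta eta0 [hN Nth]]]] := adapted_norm rth.
have [d d0 [dex dest]] := step_expansion eta0.
have D2 : 0 < D ^+ 2 by rewrite exprn_gt0.
have N0 z : 0 <= N z.
  by have [+ _] := hN z; rewrite -(pmulr_rge0 _ D0); apply: le_trans.
have ND z y k : N z <= th ^+ k * N y -> `|z| <= D ^+ 2 * th ^+ k * `|y|.
  move=> zy; rewrite (le_trans (hN z).1)// expr2 -!mulrA ler_wpM2l ?(ltW D0)//.
  by rewrite (le_trans zy)// mulrCA ler_wpM2l ?exprn_ge0// (hN y).2.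
have near_d z y k : `|y| < d / D ^+ 2 -> N z <= th ^+ k * N y -> `|z| < d.
  move=> yd /ND/le_lt_trans; apply.
  rewrite ltr_pdivlMr// mulrC in yd; apply: le_lt_trans yd.
  by rewrite -mulrA ler_wpM2l ?(ltW D2)// ler_piMl// exprn_ile1// ltW.
have stepN M U M' : `|M - Ms| < d -> step M U M' -> N (M' - Ms) <= th * N (M - Ms).
  by move=> Md sM; apply: Nth; have [] := dest _ _ _ Md sM.
exists (d / D ^+ 2); first by rewrite divr_gt0.
exists (D ^+ 2) => // m md; split.
  (* A sweep is chosen for each [M] in the ball, with a default value outside; the orbit built from
     it stays where the choice is genuine. *)
  have /choice[nxt hnxt] : forall M, exists p : 'cV[R]_q * 'cV[R]_q,
      `|M - Ms| < d -> step M p.1 p.2.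
    move=> M; have [/dex[U [M' s]]|h] := boolP (`|M - Ms| < d).
      by exists (U, M').
    by exists (0, 0).
  pose x k := iter k (fun p => nxt p.2) ((0 : 'cV[R]_q), m).
  have xN k : N ((x k).2 - Ms) <= th ^+ k * N (m - Ms).
    elim: k => [|k ih]; first by rewrite mul1r.
    have xd := near_d _ _ _ md ih.
    rewrite exprS -mulrA (le_trans (stepN _ _ _ xd (hnxt _ xd)))//.
    by rewrite ler_wpM2l.
  by exists x; split=> // k; apply: hnxt; exact: near_d (xN k).
move=> x [x0 xs] k; apply: ND.
elim: k => [|k ih]; first by rewrite mul1r x0.
have xd := near_d _ _ _ md ih.
by rewrite exprS -mulrA (le_trans (stepN _ _ _ xd (xs k)))// ler_wpM2l.
Qed.

Lemma geometric_le (K mu rho : R) : 0 <= mu < rho ->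
  \forall k \near \oo, K * mu ^+ k <= rho ^+ k.
Proof.
move=> murho; near=> k; rewrite -[leRHS]mul1r ltW//.
by near: k; exact: geometric_lt.
Unshelve. all: end_near. Qed.

(** The radius in [orbit_bound] depends on [th], whereas here one [d] must serve all [th]. The
    factor [(rho + 1) / 2] fixes [d] and forces convergence; after [k0] steps the orbit enters the
    smaller ball belonging to a factor [t < th], and the tail obeys the sharper bound. *)
Lemma orbit_upper : spectral_radius A < 1 ->
  exists2 d, 0 < d & forall m, `|m - Ms| < d ->
    orbits m !=set0 /\
    forall x, orbits m x -> forall th, spectral_radius A < th ->
      (\forall k \near \oo, `|(x k).2 - Ms| <= th ^+ k) /\
      (\forall k \near \oo, `|(x k).1 - Us| <= th ^+ k).
Proof.
set rho := spectral_radius A => rho1; have rho0 : 0 <= rho := spectral_radius_ge0 A.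
have [|d d0 [K K0 hd]] := @orbit_bound ((rho + 1) / 2).
  by rewrite -/rho; apply/andP; split; lra.
have [d1 d10 [_ hd1]] := step_expansion (@ltr01 R).
exists d => // m md; have [mx hx] := hd _ md; split=> // x Sx th rhoth.
have small e : 0 < e -> \forall k \near \oo, `|(x k).2 - Ms| < e.
  move=> e0; have : \forall k \near \oo,
      K * `|m - Ms| * ((rho + 1) / 2) ^+ k < e * 1 ^+ k.
    by apply: geometric_lt => //; apply/andP; split; lra.
  apply: filterS => k; rewrite expr1n mulr1; apply: le_lt_trans.
  by rewrite mulrAC hx.
pose m1 := Num.min th 1.
have [m1th m11 rm1] : [/\ m1 <= th, m1 <= 1 & rho < m1].
  by rewrite !ge_min !lexx orbT lt_min rhoth.
(* [t < 1] is required by [orbit_bound], and [t < th] lets [th ^ k] absorb the constants in front of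
   [t ^ k]. *)
pose t := (rho + m1) / 2.
have [rt tm1] : rho < t /\ t < m1 by rewrite /t; split; lra.
have t0 : 0 < t by lra.
have [|d' d'0 [K' K'0 hd']] := @orbit_bound t.
  by rewrite -/rho rt (lt_le_trans tm1).
have [k0 _ /(_ k0 (leqnn k0))/= hk0] := small d' d'0.
pose c := K' * `|(x k0).2 - Ms| / t ^+ k0.
have c0 : 0 <= c by rewrite divr_ge0 ?mulr_ge0 ?exprn_ge0// ltW.
have bound : \forall k \near \oo, `|(x k).2 - Ms| <= c * t ^+ k.
  exists k0 => // k /= k0k.
  have Sy : orbits (x k0).2 (fun j => x (j + k0)%N).
    by split=> [|j]; rewrite ?add0n//; case: Sx => _; apply.
  have := (hd' _ hk0).2 _ Sy (k - k0)%N; rewrite subnK// => /le_trans; apply.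
  rewrite /c -[in leRHS](subnK k0k) exprD.
  rewrite le_eqVlt; apply/orP; left; apply/eqP; field.
  by rewrite expf_neq0 ?gt_eqF.
have murho : 0 <= t < th by rewrite (ltW t0) (lt_le_trans tm1).
split.
  near=> k; apply: (@le_trans _ _ (c * t ^+ k)); first by near: k.
  by near: k; exact: geometric_le.
(* [U] at [k + 1] is controlled by [M] at [k]; the shift of index costs the factor [1 / t]. *)
have bU : \forall k \near \oo, `|(x k.+1).1 - Us| <= C * c / t * t ^+ k.+1.
  near=> k; have [|_ + _] := hd1 _ _ _ _ (Sx.2 k); first by near: k; exact: small.
  move=> /le_trans; apply.
  have -> : C * c / t * t ^+ k.+1 = C * (c * t ^+ k).
    by rewrite exprS; field; rewrite gt_eqF.
  by rewrite ler_wpM2l ?(ltW C0)//; near: k.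
have bU' : \forall k \near \oo, `|(x k).1 - Us| <= C * c / t * t ^+ k.
  exact: near_inftyS.
near=> k; apply: (@le_trans _ _ (C * c / t * t ^+ k)); first by near: k.
by near: k; exact: geometric_le.
Unshelve. all: end_near. Qed.

(** The start is [Ms] plus a small multiple of a cone vector. The errors of [M] remain in the cone
    and [N1] keeps at least a factor [s] per step, where [sg < s < rho] leaves room for the
    constants. *)
Lemma orbit_lower sg (W : set 'cV[R]_q) :
  0 < spectral_radius A < 1 -> 0 <= sg < spectral_radius A -> nbhs Ms W ->
  exists2 m, W m & forall x, orbits m x ->
    (\forall k \near \oo, sg ^+ k <= `|(x k).2 - Ms|) /\
    (\forall k \near \oo, sg ^+ k <= `|(x k).1 - Us|).
Proof.
set rho := spectral_radius A => /andP[rho0 rho1] /andP[sg0 sgrho].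
move=> /nbhs_normP[dW /= dW0 hW].
have [|d d0 [K K0 hd]] := @orbit_bound ((rho + 1) / 2).
  by rewrite -/rho; apply/andP; split; lra.
pose s := (sg + rho) / 2.
have [sgs srho] : sg < s /\ s < rho by rewrite /s; split; lra.
have s0 : 0 < s by lra.
have [N1 [N2 [N1S N2S [D D0 hD] [z z12] [eta eta0 cone]]]] := expanding_cone rho0 srho.
have [d1 d10 [_ hd1]] := step_expansion eta0.
(* The three bounds place the start in [W], make [orbit_bound] applicable, and keep all iterates
   within [d1], where the cone estimate holds. *)
pose d' := Num.min dW (Num.min d (d1 / K)).
have d'0 : 0 < d' by rewrite !lt_min dW0 d0 divr_gt0.
have [d'W d'd d'1] : [/\ d' <= dW, d' <= d & d' <= d1 / K].
  by rewrite /d' !ge_min !lexx !orbT.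
pose r := d' / (`|z| + 1).
have r0 : 0 < r by rewrite divr_gt0// ltr_wpDl.
have rz : `|r *: z| < d'.
  rewrite normrZ gtr0_norm// /r mulrAC -mulrA gtr_pMr// ltr_pdivrMr ?ltr_wpDl//.
  by rewrite mul1r ltrDl.
pose m := Ms + r *: z.
have mz : m - Ms = r *: z by rewrite /m addrAC subrr add0r.
exists m; first by apply: hW; rewrite /= distrC mz (lt_le_trans rz).
move=> x Sx; have [xm xs] := Sx.
have md : `|m - Ms| < d by rewrite mz (lt_le_trans rz).
have xd k : `|(x k).2 - Ms| < d1.
  apply: (le_lt_trans ((hd _ md).2 _ Sx k)).
  have : `|m - Ms| < d1 / K by rewrite mz (lt_le_trans rz).
  rewrite ltr_pdivlMr// mulrC; apply: le_lt_trans.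
  rewrite ler_wpM2r// ler_piMr ?(ltW K0)// exprn_ile1//; lra.
have conex k : N2 ((x k).2 - Ms) < N1 ((x k).2 - Ms) /\
    s ^+ k * N1 (m - Ms) <= N1 ((x k).2 - Ms).
  elim: k => [|k [ih1 ih2]].
    rewrite xm mul1r mz; split=> //.
    by case: N1S N2S => _ -> [_ ->]; rewrite ltr_pM2l ?normr_gt0 ?gt_eqF.
  have [e1 _ _] := hd1 _ _ _ (xd k) (xs k).
  have [h1 h2] := cone _ _ e1 ih1; split=> //.
  by rewrite exprS -mulrA (le_trans _ h2)// ler_wpM2l// ltW.
have N1m : 0 < N1 (m - Ms).
  have [+ _] := conex 0%N; rewrite xm; apply: le_lt_trans.
  exact: (seminorm_ge0 _ N2S).
pose c := N1 (m - Ms) / D.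
have c0 : 0 < c by rewrite divr_gt0.
have low k : c * s ^+ k <= `|(x k).2 - Ms|.
  rewrite -(ler_pM2l D0) (le_trans _ (hD _))// (le_trans _ (conex k).2)//.
  by rewrite /c le_eqVlt; apply/orP; left; apply/eqP; field; rewrite gt_eqF.
have sgs' : 0 <= sg < s by rewrite sg0.
split.
  near=> k; rewrite (le_trans _ (low k))// -[leLHS]mul1r ltW//.
  by near: k; exact: geometric_lt.
(* The error of [M] at [k + 1] is at most [C] times that of [U] at the same index, so only index 0,
   where [U] is free, has to be skipped. *)
have lowU : \forall k \near \oo, c / C * s ^+ k <= `|(x k).1 - Us|.
  apply: near_inftyS; apply: nearW => k.
  rewrite -(ler_pM2l C0); have [_ _] := hd1 _ _ _ (xd k) (xs k).
  apply: le_trans; rewrite mulrA [C * _]mulrC divfK ?gt_eqF//; exact: low.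
near=> k; apply: (@le_trans _ _ (c / C * s ^+ k)); last by near: k.
rewrite -[leLHS]mul1r ltW//; near: k; apply: geometric_lt => //.
by rewrite divr_gt0.
Unshelve. all: end_near. Qed.

End Steps.

(** * From geometric bounds to convergence and its rate *)

Section Rates.
Context (q : nat) (S : 'cV[R]_q -> set (nat -> 'cV[R]_q * 'cV[R]_q)).
Context (Ms : 'cV[R]_q) (pr : 'cV[R]_q * 'cV[R]_q -> 'cV[R]_q) (l : 'cV[R]_q).
Context (rho : R).
Hypotheses (rho0 : 0 <= rho).
Hypothesis upper : \forall m \near Ms, S m !=set0 /\
  forall x, S m x -> forall th, rho < th ->
    \forall k \near \oo, `|pr (x k) - l| <= th ^+ k.

Lemma converges_locally_of_upper : rho < 1 -> converges_locally S Ms pr l.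
Proof.
move=> rho1; apply: filterS upper => m [mS hm]; split=> // x Sx.
apply/cvgrPdist_lt => e e0.
have rt : rho < (rho + 1) / 2 by lra.
have near1 : \forall k \near \oo, ((rho + 1) / 2) ^+ k < e.
  suff : \forall k \near \oo, 1 * ((rho + 1) / 2) ^+ k < e * 1 ^+ k.
    by apply: filterS => k; rewrite expr1n mulr1 mul1r.
  by apply: geometric_lt => //; rewrite divr_ge0 ?addr_ge0//=; lra.
near=> k; rewrite distrC; apply: (@le_lt_trans _ _ (((rho + 1) / 2) ^+ k)).
  by near: k; exact: hm.
by near: k.
Unshelve. all: end_near. Qed.

Hypothesis lower : forall sg (W : set 'cV[R]_q), 0 <= sg < rho -> nbhs Ms W ->
  exists2 m, W m & forall x, S m x ->
    \forall k \near \oo, sg ^+ k <= `|pr (x k) - l|.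

Lemma convergence_rate_of_bounds : has_convergence_rate S Ms pr l rho.
Proof.
have /nbhs_normP[d /= d0 hd] := upper.
pose W0 := [set m : 'cV[R]_q | `|Ms - m| < d].
have nW0 : nbhs Ms W0 by apply/(nbhs_normP Ms (fun m => W0 m)); exists d.
exists W0; first by split=> // m /hd[].
move=> W nW WW0; apply/eqP; rewrite eq_le; apply/andP; split.
  apply: ge_ereal_sup => _ [x [m Wm Sx] <-]; apply/lee_addgt0Pr => e e0.
  rewrite -EFinD; apply: root_factor_le; first by rewrite addr_ge0// ltW.
  by apply: (hd _ (WW0 _ Wm)).2 Sx _ _; rewrite ltrDl.
(* For [rho = 0] there is no [sg] with [0 <= sg < rho]; nonnegativity of the root factor suffices,
   applied to an orbit that exists. *)
have [->|rho_neq0] := eqVneq rho 0.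
  have Wm := nbhs_singleton nW.
  have [[x Sx] _] := hd _ (WW0 _ Wm).
  apply: le_trans (root_factor_ge0 (pr \o x) l) _.
  by apply: ereal_sup_ubound; exists x => //; exists Ms.
apply/lee_subgt0Pr => e e0; rewrite -EFinB.
pose sg := Num.max 0 (rho - e).
have [sg0 sge] : 0 <= sg < rho /\ rho - e <= sg.
  rewrite /sg !le_max !lexx orbT gt_max lt_neqAle eq_sym rho_neq0 rho0.
  by rewrite ltrBlDr ltrDl.
have [m Wm hm] := lower sg0 nW.
have [[x Sx] _] := hd _ (WW0 _ Wm).
apply: (@le_trans _ _ sg%:E); first by rewrite lee_fin.
apply: (@le_trans _ _ (root_factor (pr \o x) l)).
  by apply: root_factor_ge; [case/andP: sg0|exact: hm].
by apply: ereal_sup_ubound; exists x => //; exists m.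
Qed.

End Rates.
End Iterations.

(** * Alternating sweeping *)

Section Sweeping.
Context {R : realType}.

Lemma nbhs_normE (V : normedModType R) (x : V) (P : set V) :
  nbhs x P <-> exists2 d, 0 < d & forall y, `|y - x| < d -> P y.
Proof.
split=> [/(nbhs_normP x P)[d /= d0 hd]|[d d0 hd]].
  by exists d => // y yx; apply: hd; rewrite /= distrC.
by apply/(nbhs_normP x P); exists d => // y /=; rewrite distrC; exact: hd.
Qed.

Lemma nbhs_norm_lt (V : normedModType R) (x : V) e :
  0 < e -> nbhs x [set y | `|y - x| < e].
Proof. by move=> e0; apply/nbhs_normE; exists e. Qed.

Lemma nbhs_norm_le (V : normedModType R) (x : V) e :
  0 < e -> nbhs x [set y | `|y - x| <= e].
Proof. by move=> e0; apply/nbhs_normE; exists e => // y /ltW. Qed.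

Lemma differentiable_swap (V W : normedModType R) (p : V * W) :
  differentiable (fun r : V * W => (r.2, r.1)) p.
Proof.
have cfst : continuous (fst : V * W -> V) by move=> r; exact: cvg_fst.
have csnd : continuous (snd : V * W -> W) by move=> r; exact: cvg_snd.
by apply: differentiable_pair; exact: linear_differentiable.
Qed.

(** The swap exchanges [jacU] and [jacM], so the results on solving for the first variable also
    solve [G] for [M]. *)
Lemma continuously_differentiable_swap q (H : 'cV[R]_q * 'cV[R]_q -> 'cV[R]_q) :
  continuously_differentiable H ->
  continuously_differentiable (fun p => H (p.2, p.1)).
Proof.
move=> [dH cU cM].
have cswap p := differentiable_continuous
  (@differentiable_swap ('cV[R]_q) ('cV[R]_q) p).
split=> [p|p|p].
- exact: (differentiable_comp (differentiable_swap p) (dH (p.2, p.1))).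
- exact: (continuous_comp (cswap p) (cM (p.2, p.1))).
- exact: (continuous_comp (cswap p) (cU (p.2, p.1))).
Qed.

Section LocalSolution.
Context (q : nat) (H : 'cV[R]_q * 'cV[R]_q -> 'cV[R]_q) (p : 'cV[R]_q * 'cV[R]_q).
Hypotheses (hH : continuously_differentiable H) (uJ : jacU H p \in unitmx).
Hypothesis Hp0 : H p = 0.

Lemma local_window : exists dom win : set 'cV[R]_q,
  [/\ nbhs p.2 dom, nbhs p.1 win &
      forall M, dom M -> exists! U, win U /\ H (U, M) = 0].
Proof.
have [r r0 hr] := implicit_unique hH uJ.
exists [set M | `|M - p.2| <= r /\ exists U, `|U - p.1| <= r /\ H (U, M) = 0].
exists [set U | `|U - p.1| <= r]; split; [|exact: (nbhs_norm_le p.1 r0)|].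
  by exact: (filterI (nbhs_norm_le p.2 r0) (implicit_exists hH uJ Hp0 r0)).
move=> M /= [Mr [U [Ur HU]]]; exists U; split=> // U' [U'r HU'].
exact: hr Mr Ur U'r HU HU'.
Qed.

(** The windows are arbitrary, but for [M] near [p.2] the solution from [implicit_exists] is close
    enough to [p.1] to lie in [win]. By uniqueness in the window it is the selected one, and
    inherits the expansion. *)
Lemma local_solution (dom win : set 'cV[R]_q) e e' :
  nbhs p.2 dom -> nbhs p.1 win ->
  (forall M, dom M -> exists! U, win U /\ H (U, M) = 0) -> 0 < e -> 0 < e' ->
  exists2 d, 0 < d & forall M, `|M - p.2| < d ->
    [/\ dom M, exists U, win U /\ H (U, M) = 0 &
        forall U, win U -> H (U, M) = 0 -> `|U - p.1| < e' /\
          `|U - p.1 + invmx (jacU H p) *m jacM H p *m (M - p.2)|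
             <= e * `|M - p.2|].
Proof.
move=> ndom nwin exU e0 e'0.
have [d1 d10 hd1] := implicit_expansion hH uJ Hp0 e0.
have /nbhs_normE[d2 d20 hd2] := nwin.
pose s := Num.min (Num.min d1 d2) e' / 2.
have [s0 [s1 s2 se]] : 0 < s /\ [/\ s < d1, s < d2 & s < e'].
  have m0 : 0 < Num.min (Num.min d1 d2) e' by rewrite !lt_min d10 d20.
  have : [/\ Num.min (Num.min d1 d2) e' <= d1, Num.min (Num.min d1 d2) e' <= d2
    & Num.min (Num.min d1 d2) e' <= e'] by rewrite !ge_min !lexx !orbT.
  by rewrite /s => -[? ? ?]; do !split; lra.
have [d d0 hd] := (nbhs_normE _ _).1 (filterI (nbhs_norm_lt p.2 d10)
  (filterI ndom (implicit_exists hH uJ Hp0 s0))).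
exists d => // M Md; have [Md1 [domM [U0 [U0s HU0]]]] := hd M Md.
have winU0 : win U0 by exact: hd2 (le_lt_trans U0s s2).
split=> //; first by exists U0.
move=> U wU HU; have [U1 [_ uniq1]] := exU _ domM.
have -> : U = U0 by rewrite -(uniq1 U)// -(uniq1 U0).
split; first exact: le_lt_trans U0s se.
exact: hd1 (le_lt_trans U0s s1) Md1 HU0.
Qed.

End LocalSolution.

Lemma spectral_radius_mulC q (X Y : 'M[R]_q) :
  spectral_radius (X *m Y) = spectral_radius (Y *m X).
Proof.
have EC (Z W : 'M[R]_q) a : eigenvalue (map_mx (real_complex R) (Z *m W)) a ->
    eigenvalue (map_mx (real_complex R) (W *m Z)) a.
  by rewrite !map_mxM; exact: eigenvalue_mulC.
have sub (Z W : 'M[R]_q) :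
    [set ComplexField.Normc.normc a | a in
      [set a : R[i] | eigenvalue (map_mx (real_complex R) (Z *m W)) a]] `<=`
    [set ComplexField.Normc.normc a | a in
      [set a : R[i] | eigenvalue (map_mx (real_complex R) (W *m Z)) a]].
  by move=> _ [a /EC ea <-]; exists a.
by apply: (congr1 sup); apply/seteqP; split; exact: sub.
Qed.

Definition sweep_step q (F G : 'cV[R]_q * 'cV[R]_q -> 'cV[R]_q)
    (w : windows 'cV[R]_q) (M U M' : 'cV[R]_q) : Prop :=
  [/\ domM w M, winU w U & F (U, M) = 0] /\
  [/\ domU w U, winM w M' & G (U, M') = 0].

(** With increments [v], [u], [v'] of [M], [U], [M'], the two expansions are [u = - Y v + o(v)] and
    [v' = - X u + o(u)]; the signs cancel in the composition [v' = X Y v + o(v)]. *)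
Lemma sweep_step_expansion q (F G : 'cV[R]_q * 'cV[R]_q -> 'cV[R]_q) Us Ms
    (w : windows 'cV[R]_q) :
  continuously_differentiable F -> continuously_differentiable G ->
  F (Us, Ms) = 0 -> G (Us, Ms) = 0 ->
  jacU F (Us, Ms) \in unitmx -> jacM G (Us, Ms) \in unitmx ->
  local_windows F G Us Ms w ->
  let A := invmx (jacM G (Us, Ms)) *m jacU G (Us, Ms) *m
           invmx (jacU F (Us, Ms)) *m jacM F (Us, Ms) in
  exists2 C, 0 < C & forall e, 0 < e -> exists2 d, 0 < d &
  (forall M, `|M - Ms| < d -> exists U M', sweep_step F G w M U M') /\
  forall M U M', `|M - Ms| < d -> sweep_step F G w M U M' ->
    [/\ `|M' - Ms - A *m (M - Ms)| <= e * `|M - Ms|,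
        `|U - Us| <= C * `|M - Ms| & `|M' - Ms| <= C * `|U - Us|].
Proof.
move=> hF hG F0 G0 uF uG [[nM nU] [nU' nM'] exF exG] A.
pose X := invmx (jacM G (Us, Ms)) *m jacU G (Us, Ms).
pose Y := invmx (jacU F (Us, Ms)) *m jacM F (Us, Ms).
have AE : A = X *m Y by rewrite /A /X /Y !mulmxA.
pose x := q%:R * `|X|; pose y := q%:R * `|Y|.
have x0 : 0 <= x by rewrite mulr_ge0.
have y0 : 0 <= y by rewrite mulr_ge0.
have hX z : `|X *m z| <= x * `|z| := mulmx_norm_le X z.
have hY z : `|Y *m z| <= y * `|z| := mulmx_norm_le Y z.
clearbody x y; pose C := 1 + x + y.
have C0 : 0 < C by rewrite /C; lra.
exists C => // e e0.
(* The total error is at most [e1 * (C + x) * |v|], and [C + x <= 2 * C]; [e1 <= 1] makes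
   [C = 1 + x + y] a valid bound in both norm estimates. *)
pose e1 := Num.min 1 (e / (2 * C)).
have C20 : 0 < 2 * C by rewrite mulr_gt0.
have e10 : 0 < e1 by rewrite lt_min ltr01 divr_gt0.
have e11 : e1 <= 1 by rewrite ge_min lexx.
have e1C : e1 * (2 * C) <= e by rewrite -ler_pdivlMr// ge_min lexx orbT.
(* The radius for [G] comes first: it is then the accuracy demanded of [U] when solving [F], so that
   the second half of the sweep is possible. *)
have [dG dG0 hdG] := @local_solution q (fun p => G (p.2, p.1)) (Ms, Us)
  (continuously_differentiable_swap hG) uG G0 _ _ e1 1 nU' nM' exG e10 ltr01.
have [dF dF0 hdF] := local_solution hF uF F0 nM nU exF e10 dG0.
exists dF => //; split.
  move=> M /hdF[domM [U [wU FU]] /(_ U wU FU)[/hdG[domU [M' [wM' GM']] _] _]].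
  by exists U, M'.
move=> M U M' /hdF[_ _ hU] [[domM wU FU] [domU wM' GM']].
have [/hdG[_ _ hM'] hu] := hU U wU FU; have {hM'}[_ hv'] := hM' M' wM' GM'.
have {}hu : `|U - Us + Y *m (M - Ms)| <= e1 * `|M - Ms| := hu.
have {}hv' : `|M' - Ms + X *m (U - Us)| <= e1 * `|U - Us| := hv'.
rewrite AE; clearbody X Y.
move: (M - Ms) (M' - Ms) (U - Us) hu hv' => v v' u hu hv'.
have hYv := hY v; have hXu := hX u.
have u_le : `|u| <= C * `|v|.
  rewrite -[X in `|X|](addrK (Y *m v)) (le_trans (ler_normB _ _))//.
  have := ler_wpM2r (normr_ge0 v) e11; have := mulr_ge0 x0 (normr_ge0 v).
  by rewrite /C; lra.
split=> //.
  rewrite -mulmxA.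
  have -> : v' - X *m (Y *m v) = (v' + X *m u) - X *m (u + Y *m v).
    by rewrite mulmxDr opprD addrA addrK.
  rewrite (le_trans (ler_normB _ _))//.
  have h1 : `|X *m (u + Y *m v)| <= x * (e1 * `|v|).
    by rewrite (le_trans (hX _))// ler_wpM2l.
  have h2 := ler_wpM2l (ltW e10) u_le.
  have h3 := ler_wpM2r (normr_ge0 v) e1C.
  have h4 : 0 <= e1 * `|v| by rewrite mulr_ge0// ltW.
  have h5 := mulr_ge0 y0 h4.
  apply: (le_trans _ h3); apply: (le_trans (lerD hv' h1)).
  by apply: (le_trans (lerD h2 (lexx _))); rewrite /C; lra.
rewrite -[X in `|X|](addrK (X *m u)) (le_trans (ler_normB _ _))//.
have := ler_wpM2r (normr_ge0 u) e11; have := mulr_ge0 y0 (normr_ge0 u).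
by rewrite /C; lra.
Qed.
End Sweeping.

Theorem proposition1 (R : realType) (q : nat)
    (F G : 'cV[R]_q * 'cV[R]_q -> 'cV[R]_q) (Us Ms : 'cV[R]_q)
    (hF : continuously_differentiable F) (hG : continuously_differentiable G)
    (hF0 : F (Us, Ms) = 0) (hG0 : G (Us, Ms) = 0) :
  let Fu := jacU F (Us, Ms) in
  let Fm := jacM F (Us, Ms) in
  let Gu := jacU G (Us, Ms) in
  let Gm := jacM G (Us, Ms) in
  Fu \in unitmx -> Gm \in unitmx ->
  let A := invmx Gm *m Gu *m invmx Fu *m Fm in
  let B := invmx Fu *m Fm *m invmx Gm *m Gu in
  (exists w : windows 'cV[R]_q, local_windows F G Us Ms w) /\
  forall w : windows 'cV[R]_q, local_windows F G Us Ms w ->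
    let S := sweeping F G w in
    [/\ spectral_radius A < 1 -> converges_locally S Ms snd Ms,
        spectral_radius B < 1 -> converges_locally S Ms fst Us,
        spectral_radius A < 1 <-> spectral_radius B < 1
      & spectral_radius A < 1 ->
        exists r : R,
          [/\ r = spectral_radius A, r = spectral_radius B,
              has_convergence_rate S Ms snd Ms r
            & has_convergence_rate S Ms fst Us r]].
Proof.
move=> Fu Fm Gu Gm uF uG A B; split.
  have [dM [wU [ndM nwU exF]]] := local_window hF uF hF0.
  have [dU [wM [ndU nwM exG]]] := @local_window _ _ (fun p => G (p.2, p.1)) (Ms, Us)
    (continuously_differentiable_swap hG) uG hG0.
  by exists (Windows dM wU dU wM).
move=> w hw S.
(* [A] and [B] are the products of the same two matrices in opposite orders. *)
have AB : spectral_radius B = spectral_radius A.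
  have -> : A = (invmx Gm *m Gu) *m (invmx Fu *m Fm) by rewrite /A !mulmxA.
  have -> : B = (invmx Fu *m Fm) *m (invmx Gm *m Gu) by rewrite /B !mulmxA.
  exact: spectral_radius_mulC.
have [C C0 hC] := sweep_step_expansion hF hG hF0 hG0 uF uG hw.
have upper : spectral_radius A < 1 -> \forall m \near Ms, S m !=set0 /\
    forall x, S m x -> forall th, spectral_radius A < th ->
      (\forall k \near \oo, `|(x k).2 - Ms| <= th ^+ k) /\
      (\forall k \near \oo, `|(x k).1 - Us| <= th ^+ k).
  move=> A1; have [d d0 hd] := orbit_upper C0 hC A1.
  by apply/nbhs_normE; exists d.
have lower sg W : 0 < spectral_radius A < 1 -> 0 <= sg < spectral_radius A ->
    nbhs Ms W -> exists2 m, W m & forall x, S m x ->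
      (\forall k \near \oo, sg ^+ k <= `|(x k).2 - Ms|) /\
      (\forall k \near \oo, sg ^+ k <= `|(x k).1 - Us|).
  by move=> h1 h2 nW; have [m Wm hm] := orbit_lower C0 hC h1 h2 nW; exists m.
clearbody A B S; have A0 := spectral_radius_ge0 A.
rewrite AB; move: (spectral_radius A) A0 upper lower {AB} => rho A0 upper lower.
have upperM (A1 : rho < 1) : \forall m \near Ms, S m !=set0 /\
    forall x, S m x -> forall th, rho < th ->
      \forall k \near \oo, `|(x k).2 - Ms| <= th ^+ k.
  apply: (filterS _ (upper A1)) => m [mS hm]; split=> // x Sx th Ath.
  exact: (hm x Sx th Ath).1.
have upperU (A1 : rho < 1) : \forall m \near Ms, S m !=set0 /\
    forall x, S m x -> forall th, rho < th ->
      \forall k \near \oo, `|(x k).1 - Us| <= th ^+ k.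
  apply: (filterS _ (upper A1)) => m [mS hm]; split=> // x Sx th Ath.
  exact: (hm x Sx th Ath).2.
split=> [A1|A1||A1].
- exact: converges_locally_of_upper A0 (upperM A1) A1.
- exact: converges_locally_of_upper A0 (upperU A1) A1.
- by [].
(* Positivity of [rho], required by [lower], follows from [0 <= sg < rho]. *)
have lower' sg W : 0 <= sg < rho -> nbhs Ms W ->
    exists2 m, W m & forall x, S m x ->
      (\forall k \near \oo, sg ^+ k <= `|(x k).2 - Ms|) /\
      (\forall k \near \oo, sg ^+ k <= `|(x k).1 - Us|).
  by move=> /[dup] /andP[sg0 sgA]; apply: lower; rewrite A1 (le_lt_trans sg0).
exists rho; split=> //.
  apply: (convergence_rate_of_bounds A0 (upperM A1)) => sg W hsg nW.
  by have [m Wm hm] := lower' _ _ hsg nW; exists m => // x /hm[].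
apply: (convergence_rate_of_bounds A0 (upperU A1)) => sg W hsg nW.
by have [m Wm hm] := lower' _ _ hsg nW; exists m => // x /hm[].
Qed.
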